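(* Let $P$ be the transition kernel on $\mathbb{R}^d$ of the nonlinear autoregressive process $\Phi_{n+1}=g(\Phi_n)+\varepsilon_{n+1}$, i.e. $P(x,A)=\mathbb{P}(g(x)+\varepsilon_0\in A)$, where the noise and the function $g$ satisfy the assumptions given in the context, with constants $z_0>0$, $\gamma_0\in(0,1]$, $r>0$, $R_0>0$, $\rho\in[0,2)$. (i) If $\rho>\gamma_0$, then Condition $\mathbf{D}(\phi,V,C)$ (defined in the context) holds with $$\phi(v):=c\,v\,(1+\log v)^{1-\rho/(\gamma_0\wedge(2-\rho))},\qquad V(x):=e^{z|x|^{\gamma_0\wedge(2-\rho)}},\qquad C:=\{x\in\mathbb{R}^d:|x|\le M\},$$ for some $z\in(0,z_0)$, $c>0$ and $M\ge R_0$. (ii) If $\rho\le\gamma_0$, then the Foster–Lyapunov condition $$PV\le\lambda V+b\,\mathbf{1}_C\qquad\text{for some }\lambda\in(0,1)\text{ and } b\in(0,\infty)$$ holds with $C=\{x\in\mathbb{R}^d:|x|\le M\}$ for some $M\ge R_0$ and $V(x)=e^{z|x|^{\gamma_0}}$, where $z=z_0$ if $\rho<\gamma_0$, and $z$ is some number in $(0,z_0)$ if $\rho=\gamma_0$.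
   Context: $|\cdot|$ is the Euclidean norm, $a\wedge b=\min(a,b)$, $PV(x)=\int P(x,dy)V(y)$. Condition $\mathbf{D}(\phi,V,C)$, for a kernel $P$ on a state space $\mathsf{X}$ (here $\mathsf{X}=\mathbb{R}^d$): there exist a function $V:\mathsf{X}\to[1,\infty)$, a concave monotone nondecreasing differentiable function $\phi:[1,\infty)\to(0,\infty]$, a measurable set $C$ and a finite constant $b$ such that $PV+\phi\circ V\le V+b\mathbf{1}_C$. Noise assumption: $(\varepsilon_n)_{n\ge0}$ is a sequence of i.i.d. zero mean $d$-dimensional random vectors, independent of $\Phi_0$, with $\mathbb{E}\bigl[e^{z_0|\varepsilon_0|^{\gamma_0}}\bigr]<\infty$ for some $z_0>0$ and $\gamma_0\in(0,1]$, and the distribution of $\varepsilon_0$ has a nontrivial absolutely continuous component which is bounded away from zero in a neighborhood of the origin. Assumption on $g$: $g:\mathbb{R}^d\to\mathbb{R}^d$ is continuous and there exist $r,R_0>0$ and $\rho\in[0,2)$ such that $|g(x)|\le|x|\,(1-r|x|^{-\rho})$ whenever $|x|\ge R_0$.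
   Formalization: In (i) φ is strictly convex near v=1, so never concave on [1,∞) and Condition D fails literally; proved instead: the drift inequality for the exact φ, and Condition D with the same V and C for a concave nondecreasing φ₀ that equals φ for all large v. *)

(* Defs.v *)
From HB Require Import structures.
From mathcomp Require Import all_boot all_order all_algebra.
From mathcomp Require Import all_classical all_reals all_analysis.

Set Implicit Arguments.
Unset Strict Implicit.
Unset Printing Implicit Defensive.

Import Order.TTheory GRing.Theory Num.Theory.
Import numFieldNormedType.Exports.

Local Open Scope classical_set_scope.
Local Open Scope ring_scope.

(* Borel sigma-algebra on matrices, in particular on R^d = 'rV[R]_d. *)
HB.instance Definition _ (R : realType) (m n : nat) :=
  @isMeasurable.Build (sigma_display (@open 'M[R]_(m, n))) 'M[R]_(m, n)
    <<s @open 'M[R]_(m, n) >> (@sigma_algebra0 _ setT _) (@sigma_algebraC _ _)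
    (@sigma_algebra_bigcup _ setT _).

(* The library norm on 'rV[R]_d is the sup norm, hence this definition. *)
Definition enorm (R : realType) (d : nat) (x : 'rV[R]_d) : R :=
  Num.sqrt (\sum_(i < d) x ord0 i ^+ 2).

(* d-fold product of the Lebesgue measure on R, transported along
   R * R^d ~ R^(1 + d). *)
Fixpoint lebesgue_rV (R : realType) (d : nat) : set 'rV[R]_d -> \bar R :=
  match d return set 'rV[R]_d -> \bar R with
  | 0 => fun A => \d_(0 : 'rV[R]_0) A
  | d'.+1 => pushforward (lebesgue_measure \x @lebesgue_rV R d')%E
               (fun p : measurableTypeR R * 'rV[R]_d' =>
                  row_mx p.1%:M p.2 : 'rV[R]_(1 + d'))
  end.

Section drift_conditions.
Context (R : realType) (dX : measure_display) (X : measurableType dX).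
Implicit Types (P : X -> set X -> \bar R) (V : X -> R) (C : set X).

Definition kernel_app P V (x : X) : \bar R := (\int[P x]_y (V y)%:E)%E.

Definition differentiable_from1 (phi : R -> R) : Prop :=
  (forall v : R, 1 < v -> derivable phi v 1) /\
  cvg (h^-1 * (phi (1 + h) - phi 1) @[h --> 0^'+]).

(* phi : [1, +oo) -> (0, +oo] concave, nondecreasing and differentiable; being
   differentiable it takes finite values, and it is represented by a function
   on R of which only the restriction to [1, +oo) matters. *)
Definition rate_function (phi : R -> R) : Prop :=
  [/\ forall v, 1 <= v -> 0 < phi v,
      {in `[1, +oo[ &, {homo phi : u v / u <= v}},
      convex_function (`[1, +oo[%classic : set R^o) (fun v => - phi v)
    & differentiable_from1 phi].

Definition drift P (phi : R -> R) V C (b : R) : Prop :=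
  forall x, (kernel_app P V x + (phi (V x))%:E
             <= (V x)%:E + (b * \1_C x)%:E)%E.

Definition condition_D P (phi : R -> R) V C : Prop :=
  [/\ forall x, 1 <= V x, rate_function phi, measurable C
    & exists b : R, drift P phi V C b].

(* Condition D for a rate given by a formula whose concavity and monotonicity
   hold only for large arguments, e.g. phi v = c v (1 + log v)^(-a) with a > 0:
   with u = 1 + log v, v phi''(v) = c a u^(-a-2) (a + 1 - u), so phi is strictly
   convex on 1 <= v < exp a (and decreasing near 1 when a > 1).
   The inequality is required for phi itself, and condition_D is required for a
   genuine rate function that coincides with phi on some [v0, +oo). *)
Definition condition_D_ult P (phi : R -> R) V C : Prop :=
  [/\ (forall v, 1 <= v -> 0 < phi v) /\ differentiable_from1 phi,
      exists b : R, drift P phi V C b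
    & exists (phi0 : R -> R) (v0 : R),
        [/\ 1 <= v0, forall v, v0 <= v -> phi0 v = phi v
          & condition_D P phi0 V C]].

Definition foster_lyapunov P V C (lambda b : R) : Prop :=
  forall x, (kernel_app P V x <= (lambda * V x)%:E + (b * \1_C x)%:E)%E.

End drift_conditions.

Section noise.
Context (R : realType) (dO : measure_display) (Omega : measurableType dO).
Context (Pr : probability Omega R) (d : nat).
Implicit Types (eps : nat -> {RV Pr >-> 'rV[R]_d}) (X : {RV Pr >-> 'rV[R]_d}).

Definition independent_sequence eps : Prop :=
  forall (J : seq nat) (A : nat -> set 'rV[R]_d),
    uniq J -> (forall i, measurable (A i)) ->
    (Pr (\bigcap_(i in [set` J]) (eps i @^-1` A i))
     = \prod_(i <- J) Pr (eps i @^-1` A i))%E.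

Definition identically_distributed eps : Prop :=
  forall n A, measurable A ->
    distribution Pr (eps n) A = distribution Pr (eps 0%N) A.

(* sigma(eps_0, eps_1, ...) *)
Definition sigma_sequence eps : set (set Omega) :=
  <<s [set E | exists n A, measurable A /\ E = eps n @^-1` A] >>.

Definition independent_of_sequence X eps : Prop :=
  forall B E, measurable B -> sigma_sequence eps E ->
    (Pr (X @^-1` B `&` E) = Pr (X @^-1` B) * Pr E)%E.

Definition zero_mean X : Prop :=
  forall i : 'I_d,
    Pr.-integrable setT (EFin \o (fun w => X w ord0 i)) /\
    'E_Pr[fun w => X w ord0 i]%E = 0%E.

(* Lebesgue decomposition mu = f dx + nu, with nu singular, f dx nontrivial and
   f bounded away from zero near the origin. *)
Definition ac_component_near0 (mu : set 'rV[R]_d -> \bar R) : Prop :=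
  exists (f : 'rV[R]_d -> R) (nu : {measure set 'rV[R]_d -> \bar R}),
    [/\ measurable_fun setT f /\ (forall x, 0 <= f x),
        exists N, [/\ measurable N, lebesgue_rV N = 0%E & nu (~` N) = 0%E],
        forall A, measurable A ->
          mu A = (\int[@lebesgue_rV R d]_(x in A) (f x)%:E + nu A)%E,
        (0 < \int[@lebesgue_rV R d]_x (f x)%:E)%E
      & exists delta eta : R,
          [/\ 0 < delta, 0 < eta & forall x, enorm x < delta -> eta <= f x]].

Definition noise_assumption (Phi0 : {RV Pr >-> 'rV[R]_d}) eps
    (z0 gamma0 : R) : Prop :=
  [/\ independent_sequence eps /\ identically_distributed eps,
      independent_of_sequence Phi0 eps,
      forall n, zero_mean (eps n),
      ('E_Pr[fun w => expR (z0 * enorm (eps 0%N w) `^ gamma0)] < +oo)%E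
    & ac_component_near0 (distribution Pr (eps 0%N))].

Definition nlar_kernel (g : 'rV[R]_d -> 'rV[R]_d) (eps0 : {RV Pr >-> 'rV[R]_d})
    (x : 'rV[R]_d) : set 'rV[R]_d -> \bar R :=
  pushforward Pr (fun w => g x + eps0 w).

End noise.

Definition g_assumption (R : realType) (d : nat) (g : 'rV[R]_d -> 'rV[R]_d)
    (r R0 rho : R) : Prop :=
  continuous g /\
  forall x, R0 <= enorm x ->
    enorm (g x) <= enorm x * (1 - r * enorm x `^ (- rho)).

Definition cball (R : realType) (d : nat) (M : R) : set 'rV[R]_d :=
  [set x | enorm x <= M].
Arguments cball {R} d M.

Definition expV (R : realType) (d : nat) (z gamma : R) (x : 'rV[R]_d) : R :=
  expR (z * enorm x `^ gamma).

Definition log_rate (R : realType) (c a : R) (v : R) : R :=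
  c * v * (1 + ln v) `^ a.

(* Main.v *)
Require Import Defs.
From mathcomp Require Import all_boot all_order all_algebra.
From mathcomp Require Import all_classical all_reals all_analysis.
From mathcomp Require Import measurable_realfun ring lra.

Set Implicit Arguments.
Unset Strict Implicit.
Unset Printing Implicit Defensive.

Import Order.TTheory GRing.Theory Num.Theory.
Import numFieldNormedType.Exports.

Local Open Scope classical_set_scope.
Local Open Scope ring_scope.

(** Write V(x) = exp (z |x|^g).  Since |g(x)| <= |x| - r |x|^(1 - rho), concavity
    of the power function gives |g(x)|^g <= |x|^g - g r |x|^(g - rho), so that the
    deterministic step multiplies V by exp (- z g r |x|^(g - rho)) at most
    ([enorm_contraction]).  The question is how much of this gain the noise eats.

    For y = g(x) with |y| large, the increment |y + e|^g - |y|^g is to first order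
    g |y|^(g - 2) <y, e>, which has mean zero; hence the noise costs only a factor
    1 + O (z |y|^(g - 2) + z^2 |y|^(2 g - 2)).  Concavity makes this estimate valid
    for every e, without a Taylor expansion ([enorm_powR_tangent],
    [expV_add_le_second_order]).  If |y| >= |x| / 2, the two correction terms are
    compared with |x|^(g - rho): the first is negligible because rho < 2, and the
    second is at most of the same order because g <= 2 - rho, with a coefficient
    z^2 against the gain of order z, so a small z wins ([noise_correction_le]).
    If |y| < |x| / 2, subadditivity of the power function alone suffices.
    For z small and g <= min (gamma0, rho, 2 - rho), altogether
    P V <= V (1 - k' |x|^(g - rho)) outside a ball ([drift_subgeometric]).

    For g < rho, |x|^g = ln V / z turns this factor into
    1 - c (1 + ln V)^(1 - rho / g), which is the subgeometric condition.  The
    rate is concave only for large arguments; below that range it is replaced by a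
    tangent line ([log_rate_eventually_rate_function]).  For g = rho the factor is
    a constant below 1.  When rho < gamma0, the gain |x|^(gamma0 - rho) tends to
    infinity, and subadditivity together with the exponential moment is enough,
    even for z = z0.  Inside the ball everything is bounded because g is
    continuous and closed balls are compact. *)

(** * Inequalities for real powers and exponentials *)

Section real_inequalities.
Context {R : realType}.
Implicit Types a b c s t u x y z p g : R.

Lemma ln_le_subr1 x : 0 < x -> ln x <= x - 1.
Proof. by move=> x0; have := @le_ln1Dx R (x - 1); rewrite subrKC; apply; lra. Qed.

(** Bernoulli's inequality for exponents in (0, 1]: with w the right-hand side,
    the bounds ln t <= t - 1 at t = s / w and t = 1 / w, weighted by g and
    1 - g, add up to g * ln s <= ln w. *)
Lemma powR_le_affine g s : 0 < g <= 1 -> 0 < s -> s `^ g <= 1 + g * (s - 1).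
Proof.
move=> /andP[g0 g1] s0; set w := 1 + g * (s - 1).
have w0 : 0 < w by rewrite /w; have := mulr_gt0 g0 s0; lra.
have h1 : ln s - ln w <= s / w - 1.
  by rewrite -ln_div ?posrE//; apply: ln_le_subr1; rewrite divr_gt0.
have h2 : - ln w <= w^-1 - 1.
  by rewrite -lnV ?posrE//; apply: ln_le_subr1; rewrite invr_gt0.
have h : g * (s / w - 1) + (1 - g) * (w^-1 - 1) = 0.
  have -> : g * (s / w - 1) + (1 - g) * (w^-1 - 1) = (1 + g * (s - 1)) * w^-1 - 1.
    by clearbody w; ring.
  by rewrite -/w divff ?gt_eqF// subrr.
have : g * ln s <= ln w.
  have := ler_wpM2l (ltW g0) h1; have := ler_wpM2l (_ : 0 <= 1 - g) h2.
  by move=> /(_ ltac:(lra)); lra.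
by move=> h3; rewrite /powR gt_eqF// -[leRHS]lnK ?posrE// ler_expR.
Qed.

(** The same inequality for the inverse exponent, read at w `^ p. *)
Lemma powR_ge_affine p w : 1 <= p -> 1 <= w -> 1 + p * (w - 1) <= w `^ p.
Proof.
move=> p1 w1; have p0 : 0 < p by lra.
have : (w `^ p) `^ p^-1 <= 1 + p^-1 * (w `^ p - 1).
  apply: powR_le_affine; last by rewrite powR_gt0//; lra.
  by rewrite invr_gt0 p0 invf_le1.
rewrite -powRrM mulfV ?gt_eqF// powRr1; last lra.
move=> /(ler_wpM2l (ltW p0)).
by rewrite mulrDr mulrA mulfV ?gt_eqF// => h; lra.
Qed.

(** The right-hand side is the derivative of v * (1 + ln v) `^ a at 1 + ln v = s,
    so the monotonicity expresses that this function is concave from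
    1 + ln v = 1 - a on.  With w = t / s the claim reads
    s * w + a <= (s + a) * w `^ (1 - a), and Bernoulli's inequality bounds the
    power below by an affine function of w. *)
Lemma powR_shift_antitone a s t : a < 0 -> 1 - a <= s -> s <= t ->
  t `^ (a - 1) * (t + a) <= s `^ (a - 1) * (s + a).
Proof.
move=> a0 as_ st; have s0 : 0 < s by lra.
have t0 : 0 < t by lra.
have w1 : 1 <= t / s by rewrite ler_pdivlMr// mul1r.
have w0 : 0 < t / s by rewrite divr_gt0.
have -> : t = s * (t / s) by field; exact: lt0r_neq0.
move: (t / s) w1 w0 => w w1 w0.
rewrite powRM ?(ltW s0) ?(ltW w0)// -mulrA ler_wpM2l ?powR_ge0//.
have -> : a - 1 = - (1 - a) by ring.
rewrite powRN mulrC ler_pdivrMr ?powR_gt0//.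
have h : 1 + (1 - a) * (w - 1) <= w `^ (1 - a) by apply: powR_ge_affine => //; lra.
have sa : 0 <= s + a by lra.
apply: le_trans (ler_wpM2l sa h).
have : 0 <= (- a) * (s - 1 + a) * (w - 1) by rewrite !mulr_ge0//; lra.
lra.
Qed.

(** Concavity of the power function: its graph lies below its tangent at b. *)
Lemma powR_tangent g a b : 0 < g <= 1 -> 0 <= a -> 0 < b ->
  a `^ g <= b `^ g + g * b `^ (g - 1) * (a - b).
Proof.
move=> /andP[g0 g1] a0 b0.
have bg : b `^ g = b * b `^ (g - 1) by rewrite mulr_powRB1 // ltW.
have [a0'|a0'|<-] := ltgtP 0 a; last 2 first.
- by have := lt_le_trans a0' a0; rewrite ltxx.
- have := powR_ge0 b g; rewrite powR0 ?gt_eqF// sub0r mulrN bg => h.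
  by have := ler_wpM2r h g1; lra.
have s0 : 0 < a / b by rewrite divr_gt0.
have h : (a / b) `^ g <= 1 + g * (a / b - 1) by rewrite powR_le_affine ?g0.
rewrite -[in leLHS](divfK (lt0r_neq0 b0) a) (powRM _ (ltW s0) (ltW b0)).
apply: (le_trans (ler_wpM2r (powR_ge0 b g) h)).
rewrite bg le_eqVlt; apply/orP; left; apply/eqP; field.
exact: lt0r_neq0.
Qed.

(** The other half of concavity: on [0, c] the graph lies above its chord. *)
Lemma powR_ge_chord g a c : 0 < g <= 1 -> 0 <= a <= c -> 0 < c ->
  a * c `^ (g - 1) <= a `^ g.
Proof.
move=> /andP[g0 g1] /andP[+ ac] c0; rewrite le_eqVlt => /predU1P[<-|a0].
  by rewrite mul0r powR_ge0.
rewrite -(mulr_powRB1 (ltW a0) g0) ler_pM2l// -!(opprB 1 g) !powRN.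
rewrite lef_pV2 ?posrE ?powR_gt0// ge0_ler_powR ?nnegrE ?(ltW a0) ?(ltW c0)//.
by rewrite subr_ge0.
Qed.

Lemma powR_subadditive g a b : 0 < g <= 1 -> 0 <= a -> 0 <= b ->
  (a + b) `^ g <= a `^ g + b `^ g.
Proof.
move=> g01 a0 b0; have /andP[g0 _] := g01.
have [<-|c0] := eqVneq 0 (a + b); first by rewrite powR0 ?gt_eqF// addr_ge0 ?powR_ge0.
have {}c0 : 0 < a + b by rewrite lt_neqAle c0 addr_ge0.
rewrite -(mulr_powRB1 (ltW c0) g0) mulrDl lerD// powR_ge_chord//; lra.
Qed.

(** The power function has slope of order b `^ (g - 1) near b; concavity makes
    this a global estimate, by the tangent at b when a is larger and by the
    chord over [0, b] when a is smaller. *)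
Lemma powR_dist_le g a b u : 0 < g <= 1 -> 0 <= a -> 0 < b ->
  a <= b + u -> b <= a + u -> `|a `^ g - b `^ g| <= b `^ (g - 1) * u.
Proof.
move=> g01 a0 b0 abu bau; have /andP[g0 g1] := g01.
have bg : b `^ g = b * b `^ (g - 1) by rewrite mulr_powRB1 // ltW.
have B0 := powR_ge0 b (g - 1).
have [ab|/ltW ba] := leP b a; last first.
  rewrite ler0_norm ?subr_le0 ?ge0_ler_powR ?nnegrE ?(ltW b0) ?(ltW g0)//.
  have := @powR_ge_chord g a b g01; rewrite a0 ba => /(_ isT b0) h.
  rewrite bg; nra.
rewrite ger0_norm ?subr_ge0 ?ge0_ler_powR ?nnegrE ?(ltW b0) ?(ltW g0)//.
have h := powR_tangent g01 a0 b0.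
have : g * b `^ (g - 1) * (a - b) <= b `^ (g - 1) * u.
  rewrite [g * _]mulrC -mulrA ler_wpM2l//; nra.
lra.
Qed.

Lemma powR_dist_subadd g a b u : 0 < g <= 1 -> 0 <= a -> 0 <= b -> 0 <= u ->
  a <= b + u -> b <= a + u -> `|a `^ g - b `^ g| <= u `^ g.
Proof.
move=> g01 a0 b0 u0 abu bau; have /andP[g0 g1] := g01.
have h x y : 0 <= x -> 0 <= y -> x <= y + u -> x `^ g - y `^ g <= u `^ g.
  move=> x0 y0 xyu; rewrite lerBlDl; apply: le_trans (powR_subadditive g01 y0 u0).
  by rewrite ge0_ler_powR ?nnegrE ?addr_ge0// ltW.
by rewrite ler_norml h// andbT lerNl opprB h.
Qed.

(** Both signs follow from (1 - x) * expR x <= 1. *)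
Lemma expR_le_quadratic x : expR x <= 1 + x + x ^+ 2 * expR `|x|.
Proof.
have e0 := expR_gt0 x; have := expR_ge1Dx (- x); rewrite expRN => h.
have {}h : (1 - x) * expR x <= 1.
  by have := ler_wpM2r (ltW e0) h; rewrite mulVf ?gt_eqF.
have [x0|/ltW x0] := leP 0 x.
  by rewrite ger0_norm//; nra.
have n0 : 1 <= expR `|x| by rewrite -expR0 ler_expR.
have : expR x <= 1 + x + x ^+ 2.
  rewrite -(ler_pM2l (_ : 0 < 1 - x)); last lra.
  apply: (le_trans h); nra.
have := sqr_ge0 x; nra.
Qed.

Lemma powR_le_expR t p : 0 <= t -> 0 < p -> t `^ p <= p `^ p * expR t.
Proof.
move=> t0 p0.
have s0 : 0 <= t / p by rewrite divr_ge0 // ltW.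
have -> : t = t / p * p by rewrite divfK ?gt_eqF.
rewrite expRM powRM ?(ltW p0)// [leRHS]mulrC ler_wpM2r ?powR_ge0//.
rewrite ge0_ler_powR ?nnegrE ?expR_ge0 ?(ltW p0)//.
by apply: le_trans (expR_ge1Dx _); lra.
Qed.

Lemma powR_le1D u g g' : 0 <= u -> 0 < g <= g' -> u `^ g <= 1 + u `^ g'.
Proof.
move=> u0 /andP[g0 gg']; have [u1|/ltW u1] := leP 1 u.
  by apply: (le_trans (ler_powR u1 gg')); lra.
apply: (@le_trans _ _ 1); last by rewrite lerDl powR_ge0.
have <- : 1 `^ g = 1 :> R by rewrite powR1.
by rewrite ge0_ler_powR ?nnegrE// ltW.
Qed.

Lemma expR_powR_le z z0 g g0 u : 0 <= z <= z0 -> 0 < g <= g0 -> 0 <= u ->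
  expR (z * u `^ g) <= expR z0 * expR (z0 * u `^ g0).
Proof.
move=> /andP[z_ge0 zz0] hg u0; rewrite -expRD ler_expR.
have -> : z0 + z0 * u `^ g0 = z0 * (1 + u `^ g0) by ring.
by rewrite ler_pM ?powR_ge0 ?powR_le1D.
Qed.

(** Half of the exponential moment pays for the exponential factor and the other
    half for the square, so that E [|eps|^2 exp (z |eps|^g)] is finite,
    uniformly in z <= z0 / 2 and g <= g0. *)
Lemma sqr_expR_powR_le z0 g0 : 0 < z0 -> 0 < g0 ->
  exists2 K, 0 < K & forall z g u, 0 <= z <= z0 / 2 -> 0 < g <= g0 -> 0 <= u ->
  u ^+ 2 * expR (z * u `^ g) <= K * expR (z0 * u `^ g0).
Proof.
move=> z00 g00; set p := 2 / g0; have p0 : 0 < p by rewrite divr_gt0.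
exists ((2 / z0) `^ p * p `^ p * expR (z0 / 2)).
  by rewrite !mulr_gt0 ?expR_gt0 ?powR_gt0 ?divr_gt0.
move=> z g u hz hg u0; set t := z0 / 2 * u `^ g0.
have t0 : 0 <= t by rewrite mulr_ge0 ?powR_ge0// divr_ge0// ltW.
have -> : u ^+ 2 = (2 / z0) `^ p * t `^ p.
  rewrite -powRM ?divr_ge0 ?(ltW z00)//.
  have -> : 2 / z0 * t = u `^ g0 by rewrite /t; field; rewrite gt_eqF.
  by rewrite -powRrM /p mulrC divfK ?gt_eqF// powR_mulrn.
have -> : expR (z0 * u `^ g0) = expR t * expR t by rewrite -expRD /t; congr expR; field.
have h1 := powR_le_expR t0 p0; have h2 := expR_powR_le hz hg u0.
rewrite -/t in h2.
have -> : (2 / z0) `^ p * p `^ p * expR (z0 / 2) * (expR t * expR t) =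
  ((2 / z0) `^ p * (p `^ p * expR t)) * (expR (z0 / 2) * expR t) by ring.
apply: ler_pM => //; first by rewrite mulr_ge0 ?powR_ge0.
by rewrite ler_wpM2l ?powR_ge0.
Qed.

End real_inequalities.

(** * The Euclidean norm: geometry, topology, measurability *)

Section euclidean_norm.
Context {R : realType} {d : nat}.
Implicit Types x y e : 'rV[R]_d.

Definition edot x y : R := \sum_(i < d) x ord0 i * y ord0 i.

Lemma enorm_ge0 x : 0 <= enorm x.
Proof. exact: sqrtr_ge0. Qed.

Lemma enorm_sqr x : enorm x ^+ 2 = \sum_(i < d) x ord0 i ^+ 2.
Proof. by rewrite sqr_sqrtr// sumr_ge0// => i _; rewrite sqr_ge0. Qed.

Lemma enormN x : enorm (- x) = enorm x.
Proof. by congr Num.sqrt; apply: eq_bigr => i _; rewrite mxE sqrrN. Qed.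

Lemma coord_le_enorm x i : `|x ord0 i| <= enorm x.
Proof.
rewrite -(@ler_pXn2r _ 2) ?nnegrE ?enorm_ge0// enorm_sqr real_normK ?num_real//.
by rewrite (bigD1 i)//= lerDl sumr_ge0// => j _; rewrite sqr_ge0.
Qed.

Lemma enorm_sqrD x e : enorm (x + e) ^+ 2 = enorm x ^+ 2 + 2 * edot x e + enorm e ^+ 2.
Proof.
rewrite !enorm_sqr /edot mulr_sumr -!big_split/=.
by apply: eq_bigr => i _; rewrite mxE; ring.
Qed.

(** Cauchy-Schwarz: expand the sum of the squares of |e| x_i - |x| e_i. *)
Lemma edot_le x e : edot x e <= enorm x * enorm e.
Proof.
have [x0|x0] := eqVneq (enorm x) 0.
  rewrite x0 mul0r /edot big1// => i _.
  have := coord_le_enorm x i; rewrite x0 normr_le0 => /eqP ->.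
  by rewrite mul0r.
have [e0|e0] := eqVneq (enorm e) 0.
  rewrite e0 mulr0 /edot big1// => i _.
  have := coord_le_enorm e i; rewrite e0 normr_le0 => /eqP ->.
  by rewrite mulr0.
have {}x0 : 0 < enorm x by rewrite lt_neqAle eq_sym x0 enorm_ge0.
have {}e0 : 0 < enorm e by rewrite lt_neqAle eq_sym e0 enorm_ge0.
have : 0 <= \sum_(i < d) (enorm e * x ord0 i - enorm x * e ord0 i) ^+ 2.
  by apply: sumr_ge0 => i _; rewrite sqr_ge0.
have -> : \sum_(i < d) (enorm e * x ord0 i - enorm x * e ord0 i) ^+ 2 =
    enorm e ^+ 2 * enorm x ^+ 2 - 2 * enorm x * enorm e * edot x e
    + enorm x ^+ 2 * enorm e ^+ 2.
  rewrite [in X in _ = X * _ - _ + _](enorm_sqr e).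
  rewrite -(enorm_sqr e) [X in _ * X - _](enorm_sqr x).
  rewrite [X in _ = _ + _ * X](enorm_sqr e) /edot !mulr_sumr -sumrB -big_split/=.
  by apply: eq_bigr => i _; ring.
(* Cancel the positive factor in 2 |x| |e| (|x| |e| - <x, e>) >= 0. *)
have xe : 0 < enorm x * enorm e by rewrite mulr_gt0.
by rewrite -(ler_pM2l xe (edot x e)); lra.
Qed.

Lemma ler_enormD x e : enorm (x + e) <= enorm x + enorm e.
Proof.
rewrite -(@ler_pXn2r _ 2) ?nnegrE ?addr_ge0 ?enorm_ge0//.
by rewrite enorm_sqrD; have := edot_le x e; nra.
Qed.

Lemma ler_enorm_addr x e : enorm x <= enorm (x + e) + enorm e.
Proof. by rewrite -{1}(addrK e x) -(enormN e) ler_enormD. Qed.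

Lemma enorm_continuous : continuous (@enorm R d).
Proof.
move=> x; apply: continuous_comp; last exact: sqrt_continuous.
apply: (@continuous_big R^o _ +%R); first by move=> u; exact: add_continuous.
move=> i _ u.
have := @continuous_comp _ _ _ (fun x : 'rV[R]_d => x ord0 i) (fun t : R => t ^+ 2).
by apply; [exact: coord_continuous|exact: exprn_continuous].
Qed.


Lemma cball_closed M : closed (@cball R d M).
Proof.
apply: (preimage_closed _ (@closed_le _ M)) => x _.
exact: enorm_continuous.
Qed.

(** A Euclidean ball is a closed subset of a product of segments. *)
Lemma cball_compact M : compact (@cball R d M).
Proof.
have box := @rV_compact R d (fun=> `[- M, M]%classic) (fun=> @segment_compact _ _ _).
apply: (subclosed_compact _ box); first exact: cball_closed.
move=> x xM i /=; rewrite in_itv/= -ler_norml.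
exact: le_trans (coord_le_enorm x i) xM.
Qed.

Lemma open_rV_measurable (A : set 'rV[R]_d) : open A -> measurable A.
Proof. exact: sub_sigma_algebra. Qed.

Lemma cball_measurable M : measurable (@cball R d M).
Proof.
rewrite -(setCK (@cball R d M)); apply: measurableC; apply: open_rV_measurable.
rewrite openC; exact: cball_closed.
Qed.

Lemma continuous_rV_measurable_fun (f : 'rV[R]_d -> R) :
  continuous f -> measurable_fun setT f.
Proof.
move=> /continuousP cf.
apply: (measurability _ (RGenOpens.measurableE R)).
move=> _ [_ [a [b ->] <-]]; rewrite setTI.
by apply: open_rV_measurable; apply: cf; exact: interval_open.
Qed.

Lemma translation_measurable_fun y :
  measurable_fun setT (fun x : 'rV[R]_d => (y + x : 'rV[R]_d)).
Proof.
have cD : continuous (fun x : 'rV[R]_d => (y + x : 'rV[R]_d)).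
  move=> x; apply: (@cvgD _ _ _ (nbhs x) _ (cst y) id y x).
    exact: cvg_cst.
  exact: cvg_id.
have mE : @measurable _ 'rV[R]_d = <<s @open 'rV[R]_d >> by [].
apply: (measurability _ mE).
move=> _ [B oB <-]; rewrite setTI; have /continuousP/(_ _ oB) := cD.
exact: open_rV_measurable.
Qed.

Lemma enorm_measurable_fun : measurable_fun setT (@enorm R d).
Proof. exact: continuous_rV_measurable_fun enorm_continuous. Qed.

Lemma expV_measurable_fun z g : measurable_fun setT (@expV R d z g).
Proof.
apply: measurableT_comp; first exact: measurable_expR.
apply: measurable_funM; first exact: measurable_cst.
exact: (measurableT_comp (measurable_powR g) enorm_measurable_fun).
Qed.

Lemma continuous_bounded_on_cball (f : 'rV[R]_d -> 'rV[R]_d) M :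
  continuous f -> exists2 B, 0 <= B & forall x, enorm x <= M -> enorm (f x) <= B.
Proof.
move=> cf.
have cfe : continuous (@enorm R d \o f).
  by move=> x; apply: continuous_comp; [exact: cf|exact: enorm_continuous].
have [x0|/set0P x0] := eqVneq (@cball R d M) set0.
  exists 0 => // x xM; have : @cball R d M x by [].
  by rewrite x0.
have := @EVT_max_rV _ _ (@enorm R d \o f) _ x0 (@cball_compact M).
move=> /(_ (continuous_subspaceT cfe))[c _ cM].
exists (enorm (f c)); first exact: enorm_ge0.
by move=> x xM; apply: cM; rewrite inE.
Qed.

End euclidean_norm.

(** * Effect of one noise increment on the Lyapunov function *)

Section one_step.
Context {R : realType} {d : nat}.
Implicit Types (z g : R) (y e : 'rV[R]_d).

Lemma expV_gt0 z g y : 0 < expV z g y.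
Proof. exact: expR_gt0. Qed.

Lemma expV_add z g y e :
  expV z g (y + e) =
  expV z g y * expR (z * (enorm (y + e) `^ g - enorm y `^ g)).
Proof. by rewrite /expV -expRD; congr expR; ring. Qed.

Lemma enorm_powR_dist_subadd g y e : 0 < g <= 1 ->
  `|enorm (y + e) `^ g - enorm y `^ g| <= enorm e `^ g.
Proof.
by move=> g01; apply: powR_dist_subadd; rewrite ?enorm_ge0 ?ler_enormD ?ler_enorm_addr.
Qed.

Lemma enorm_powR_dist_le g y e : 0 < g <= 1 -> 0 < enorm y ->
  `|enorm (y + e) `^ g - enorm y `^ g| <= enorm y `^ (g - 1) * enorm e.
Proof.
by move=> g01 y0; apply: powR_dist_le; rewrite ?enorm_ge0 ?ler_enormD ?ler_enorm_addr.
Qed.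

(** Linearizing the norm itself would fail at the origin.  Instead |y + e|^g is
    the concave power g / 2 of |y + e|^2 = |y|^2 + 2 <y, e> + |e|^2, and the
    tangent at |y|^2 gives a bound valid for every e, whose first-order term is
    linear in e and hence has mean zero under the noise. *)
Lemma enorm_powR_tangent g y e : 0 < g <= 1 -> 0 < enorm y ->
  enorm (y + e) `^ g - enorm y `^ g <=
  enorm y `^ (g - 2) * (g * edot y e + enorm e ^+ 2).
Proof.
move=> /andP[g0 g1] y0.
have sqE t h : 0 <= t -> (t ^+ 2) `^ h = t `^ (2 * h) :> R.
  by move=> t0; rewrite powRrM powR_mulrn.
have g2 : 0 < g / 2 <= 1 by apply/andP; split; lra.
have := powR_tangent g2 (sqr_ge0 (enorm (y + e))) (exprn_gt0 2 y0).
rewrite !sqE ?enorm_ge0//.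
have -> : 2 * (g / 2) = g by field.
have -> : 2 * (g / 2 - 1) = g - 2 by field.
rewrite enorm_sqrD => h.
have := mulr_ge0 (powR_ge0 (enorm y) (g - 2)) (sqr_ge0 (enorm e)).
(* The coefficient of |e|^2 is g / 2, rounded up to 1. *)
have g2' : 0 <= 1 - g / 2 by lra.
by move=> /mulr_ge0/(_ g2'); lra.
Qed.

(** Subadditivity of the power function: a bound without cancellation, but valid
    for all z up to z0 and for every y. *)
Lemma expV_add_le_mul z z0 g g0 y e :
  0 <= z <= z0 -> 0 < g <= g0 -> g0 <= 1 ->
  expV z g (y + e) <= expV z g y * (expR z0 * expV z0 g0 e).
Proof.
move=> hz hg g01; rewrite expV_add ler_wpM2l ?expR_ge0//.
apply: le_trans (expR_powR_le hz hg (enorm_ge0 e)); rewrite ler_expR.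
have /andP[z_ge0 _] := hz; rewrite ler_wpM2l//.
apply: (le_trans (ler_norm _)); apply: enorm_powR_dist_subadd.
by have /andP[-> /le_trans] := hg; apply.
Qed.

(** With X = z (|y + e|^g - |y|^g), use expR X <= 1 + X + X^2 expR |X|.  The term
    X is at most linear plus z |y|^(g - 2) |e|^2, X^2 is at most
    z^2 |y|^(2 g - 2) |e|^2 and |X| is at most z |e|^g.  All powers of |e| are
    then absorbed into the exponential moment, at the price of the constant K. *)
Lemma expV_add_le_second_order z z0 g g0 K y e :
  (forall z g u, 0 <= z <= z0 / 2 -> 0 < g <= g0 -> 0 <= u ->
     u ^+ 2 * expR (z * u `^ g) <= K * expR (z0 * u `^ g0)) ->
  0 <= z <= z0 / 2 -> 0 < g <= g0 -> g0 <= 1 -> 0 < enorm y ->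
  expV z g (y + e) <= expV z g y *
    (1 + z * enorm y `^ (g - 2) * g * edot y e +
     K * (z * enorm y `^ (g - 2) + z ^+ 2 * enorm y `^ (2 * g - 2)) * expV z0 g0 e).
Proof.
move=> hK hz hg g01 y0; have /andP[z_ge0 zz0] := hz.
have hg1 : 0 < g <= 1 by have /andP[-> /le_trans] := hg; apply.
rewrite expV_add ler_wpM2l ?expR_ge0//.
set D := enorm (y + e) `^ g - enorm y `^ g.
apply: (le_trans (expR_le_quadratic _)).
(* The hypothesis on K at z = 0. *)
have hm1 : enorm e ^+ 2 <= K * expV z0 g0 e.
  have := hK 0 g (enorm e); rewrite mul0r expR0 mulr1; apply => //; last exact: enorm_ge0.
  by rewrite lexx/= (le_trans z_ge0).
have hm2 := hK z g (enorm e) hz hg (enorm_ge0 e); rewrite -/(expV z0 g0 e) in hm2.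
have h1 : z * D <= z * (enorm y `^ (g - 2) * (g * edot y e + enorm e ^+ 2)).
  by rewrite ler_wpM2l// enorm_powR_tangent.
have h2 : (z * D) ^+ 2 * expR `|z * D| <=
    z ^+ 2 * enorm y `^ (2 * g - 2) * (enorm e ^+ 2 * expR (z * enorm e `^ g)).
  have -> : 2 * g - 2 = (g - 1) * 2 by ring.
  rewrite powRrM powR_mulrn ?powR_ge0// [leRHS]mulrA.
  apply: ler_pM; rewrite ?sqr_ge0 ?expR_ge0//.
    rewrite exprMn -[leRHS]mulrA -(exprMn _ _ (enorm e)) ler_wpM2l ?sqr_ge0//.
    rewrite -(real_normK (num_real D)) ler_pXn2r ?nnegrE ?mulr_ge0 ?powR_ge0 ?enorm_ge0//.
    exact: enorm_powR_dist_le.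
  by rewrite ler_expR normrM ger0_norm// ler_wpM2l// enorm_powR_dist_subadd.
have := powR_ge0 (enorm y) (g - 2); have := powR_ge0 (enorm y) (2 * g - 2).
move: (_ `^ _) (_ `^ (_ - _)) h1 h2 => B A h1 h2 B0 A0.
have h3 : z * A * enorm e ^+ 2 <= z * A * (K * expV z0 g0 e).
  by rewrite ler_wpM2l// mulr_ge0.
have h4 := ler_wpM2l (mulr_ge0 (sqr_ge0 z) B0) hm2.
lra.
Qed.

End one_step.

(** * Integrating the pointwise bounds *)

Section kernel_bounds.
Context (R : realType) (dO : measure_display) (Omega : measurableType dO).
Context (Pr : probability Omega R) (d : nat).
Context (f : 'rV[R]_d -> 'rV[R]_d) (eps0 : {RV Pr >-> 'rV[R]_d}).

Lemma kernel_app_nlar (V : 'rV[R]_d -> R) x :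
  measurable_fun setT V -> (forall y, 0 <= V y) ->
  kernel_app (nlar_kernel f eps0) V x = (\int[Pr]_w (V (f x + eps0 w))%:E)%E.
Proof.
move=> mV V0; rewrite /kernel_app /nlar_kernel.
rewrite ge0_integral_pushforward ?preimage_setT//.
- apply: (measurableT_comp (translation_measurable_fun (f x))).
  exact: measurable_funPT.
- exact/measurable_EFinP.
- by move=> y _; rewrite lee_fin.
Qed.

Lemma integrable_edot y : zero_mean eps0 ->
  Pr.-integrable setT (fun w => (edot y (eps0 w))%:E) /\
  (\int[Pr]_w (edot y (eps0 w))%:E = 0)%E.
Proof.
move=> zm.
have zi i : Pr.-integrable setT (fun w => (y ord0 i * eps0 w ord0 i)%:E).
  by have [ii _] := zm i; exact: (integrableZl measurableT (y ord0 i) ii).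
have -> : (fun w => (edot y (eps0 w))%:E) =
    (fun w => \sum_(i < d) (y ord0 i * eps0 w ord0 i)%:E)%E.
  by apply/funext => w; rewrite sumEFin.
split; first exact: integrable_sum.
rewrite integral_sum// big1// => i _.
under eq_integral do rewrite EFinM.
have [ii] := zm i; rewrite unlock => i0.
by rewrite integralZl// i0 mule0.
Qed.

(** The noise enters the pointwise bound through a linear form, which integrates
    to zero, and through a function m of finite mean. *)
Lemma kernel_app_le (V m : 'rV[R]_d -> R) x a b A y :
  measurable_fun setT V -> (forall u, 0 <= V u) ->
  measurable_fun setT m -> (forall u, 0 <= m u) ->
  ('E_Pr[m \o eps0] < +oo)%E -> zero_mean eps0 ->
  (forall e, V (f x + e) <= a + b * edot y e + A * m e) ->
  (kernel_app (nlar_kernel f eps0) V x <= (a + A * fine 'E_Pr[m \o eps0])%:E)%E.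
Proof.
move=> mV V0 mm m0 mfin zm hV.
rewrite kernel_app_nlar//.
have mme : measurable_fun setT (m \o eps0).
  by apply: (measurableT_comp mm); exact: measurable_funPT.
have im : Pr.-integrable setT (fun w => (m (eps0 w))%:E).
  apply/integrableP; split; first exact/measurable_EFinP.
  move: mfin; rewrite unlock; apply: le_lt_trans; rewrite le_eqVlt; apply/orP; left.
  by apply/eqP/eq_integral => w _; rewrite /= ger0_norm.
have [ie e0] := integrable_edot y zm.
have i1 : Pr.-integrable setT (fun=> a%:E) by exact: finite_measure_integrable_cst.
have i2 : Pr.-integrable setT (fun w => (b * edot y (eps0 w))%:E).
  exact: (integrableZl measurableT b ie).
have i3 : Pr.-integrable setT (fun w => (A * m (eps0 w))%:E).
  exact: (integrableZl measurableT A im).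
have i12 : Pr.-integrable setT (fun w => (a%:E + (b * edot y (eps0 w))%:E)%E).
  exact: integrableD.
have iS := integrableD measurableT i12 i3.
have -> : (a + A * fine 'E_Pr[m \o eps0])%:E =
    (\int[Pr]_w (a%:E + (b * edot y (eps0 w))%:E + (A * m (eps0 w))%:E))%E.
  have := integralD measurableT i12 i3; rewrite (integralD measurableT i1 i2) => ->.
  rewrite integral_cst//= probability_setT mule1.
  under [X in (_ + X + _)%E]eq_integral do rewrite EFinM.
  under [X in (_ + X)%E]eq_integral do rewrite EFinM.
  rewrite !integralZl// e0 mule0 adde0 unlock.
  by rewrite EFinD EFinM fineK//; exact: integrable_fin_num.
apply: ge0_le_integral => //.
- by move=> w _; rewrite lee_fin.
- apply/measurable_EFinP; apply: (measurableT_comp mV).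
  apply: (measurableT_comp (translation_measurable_fun (f x))).
  exact: measurable_funPT.
- exact: measurable_int iS.
- by move=> w _; rewrite -!EFinD lee_fin.
Qed.

End kernel_bounds.

(** * The drift factor in the two regimes |g(x)| >= |x| / 2 and |g(x)| < |x| / 2 *)

Section asymptotics.
Context {R : realType}.
Implicit Types g p q u y k L : R.

Lemma powR_eventually_ge g L : 0 < g -> exists M, forall u, M <= u -> L <= u `^ g.
Proof.
move=> g0; exists (`|L| `^ g^-1) => u Mu.
apply: (le_trans (ler_norm L)).
have -> : `|L| = (`|L| `^ g^-1) `^ g by rewrite -powRrM mulVf ?gt_eqF// powRr1.
by rewrite ge0_ler_powR ?nnegrE ?powR_ge0 ?(ltW g0)// (le_trans (powR_ge0 _ _) Mu).
Qed.

(** Negative powers of y are comparable with those of u once y >= u / 2; the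
    constant 4 is 2 ^ p at the largest exponent p = 2. *)
Lemma powRN_half_le p u y : 0 <= p <= 2 -> 0 < u -> u / 2 <= y ->
  y `^ (- p) <= 4 * u `^ (- p).
Proof.
move=> /andP[p0 p2] u0 uy.
have u20 : 0 < u / 2 by rewrite divr_gt0.
have y0 : 0 < y by apply: lt_le_trans uy.
rewrite !powRN -[4]invrK -invfM lef_pV2 ?posrE ?mulr_gt0 ?powR_gt0 ?invr_gt0//.
have h1 : (u / 2) `^ p <= y `^ p by rewrite ge0_ler_powR ?nnegrE ?(ltW u20) ?(ltW y0).
apply: le_trans h1; rewrite powRM ?(ltW u0) ?invr_ge0// mulrC ler_wpM2l ?powR_ge0//.
have -> : 4^-1 = 2^-1 `^ 2 :> R by rewrite powR_mulrn ?invr_ge0//; field.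
by apply: ger_powR => //; apply/andP; split; lra.
Qed.

Lemma expRN_le_affine k q : 0 < k -> 0 <= q <= 1 ->
  expR (- (k * q)) <= 1 - k / (1 + k) * q.
Proof.
move=> k0 /andP[q0 q1].
have k1 : 0 < 1 + k by lra.
have kq : 0 < 1 + k * q by have := mulr_ge0 (ltW k0) q0; lra.
rewrite expRN; apply: (@le_trans _ _ (1 + k * q)^-1).
  by rewrite lef_pV2 ?posrE ?expR_gt0// expR_ge1Dx.
rewrite -[leLHS]mul1r ler_pdivrMr//.
have -> : (1 - k / (1 + k) * q) * (1 + k * q) =
    1 + k * q * (k / (1 + k)) * (1 - q) by field; rewrite gt_eqF.
by rewrite lerDl !mulr_ge0 ?invr_ge0 ?subr_ge0 ?(ltW k0) ?(ltW k1).
Qed.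

(** Here u = |x| and y = |g(x)|.  The contraction gains z g r u^(g - rho) in the
    exponent and the noise may cost half of that.  The term z y^(g - 2) is of
    smaller order because rho < 2, that is, u^(rho - 2) is small.  The term
    z^2 y^(2 g - 2) can be of the same order, when g = 2 - rho, and is controlled
    only because z is small. *)
Lemma noise_correction_le g r rho K z u y : 0 < g <= 1 -> 0 < r -> g <= rho ->
  g <= 2 - rho -> 0 < K -> 0 < z -> 4 * K * z <= g * r / 4 ->
  1 <= u -> 16 * K / (g * r) <= u `^ (2 - rho) -> u / 2 <= y ->
  K * (z * y `^ (g - 2) + z ^+ 2 * y `^ (2 * g - 2)) <=
  z * (g * r) / 2 * u `^ (g - rho).
Proof.
move=> /andP[g0 g1] r0 grho g2rho K0 z_gt0 zK u1 h2 uy.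
have u0 : 0 < u by apply: lt_le_trans u1.
have gr0 : 0 < g * r by rewrite mulr_gt0.
set q := u `^ (g - rho); have q0 : 0 <= q by exact: powR_ge0.
have a1 : y `^ (g - 2) <= 4 * (q * u `^ (rho - 2)).
  have -> : q * u `^ (rho - 2) = u `^ (- (2 - g)).
    by rewrite -powRD ?(gt_eqF u0) ?implybT//; congr (_ `^ _); ring.
  have -> : g - 2 = - (2 - g) by ring.
  by apply: powRN_half_le => //; apply/andP; split; lra.
have a2 : y `^ (2 * g - 2) <= 4 * q.
  have -> : 2 * g - 2 = - (2 - 2 * g) by ring.
  apply: (le_trans (powRN_half_le _ u0 uy)).
    by apply/andP; split; lra.
  by rewrite ler_pM2l//; apply: ler_powR => //; lra.
have a3 : 4 * K * u `^ (rho - 2) <= g * r / 4.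
  have -> : rho - 2 = - (2 - rho) by ring.
  rewrite powRN ler_pdivrMr ?powR_gt0//.
  by move: h2; rewrite ler_pdivrMr//; lra.
have b1 := ler_wpM2l (mulr_ge0 (ltW K0) (ltW z_gt0)) a1.
have b2 := ler_wpM2l (mulr_ge0 (ltW K0) (sqr_ge0 z)) a2.
have b3 := ler_wpM2l (mulr_ge0 (ltW z_gt0) q0) a3.
have b4 := ler_wpM2l (mulr_ge0 (ltW z_gt0) q0) zK.
lra.
Qed.

(** The contraction factor is twice as strong in the exponent as the noise
    correction F, so half of it survives. *)
Lemma drift_factor_near_le k q W W' F : 0 < k -> 0 <= q <= 1 -> 0 <= W -> 0 <= W' ->
  0 <= F -> F <= k * q -> W' <= W * expR (- (2 * (k * q))) ->
  W' * (1 + F) <= W * (1 - k / (1 + k) * q).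
Proof.
move=> k0 q01 W0 W'0 F0 Fkq W'le.
apply: (@le_trans _ _ (W * expR (- (2 * (k * q))) * expR (k * q))).
  apply: ler_pM => //; first by rewrite addr_ge0.
  by apply: (le_trans _ (expR_ge1Dx _)); rewrite lerD2l.
rewrite -mulrA -expRD ler_wpM2l//.
by apply: le_trans (expRN_le_affine k0 q01); rewrite ler_expR; lra.
Qed.

(** If the deterministic step alone lowers the exponent by a large t, the crude
    constant L that the noise contributes is harmless. *)
Lemma drift_factor_far_le k q W W' L t : 0 < k -> 0 <= q <= 1 -> 0 <= W -> 0 <= L ->
  (1 + k) * L <= t -> W' <= W * expR (- t) ->
  W' * L <= W * (1 - k / (1 + k) * q).
Proof.
move=> k0 /andP[q0 q1] W0 L0 kL W'le.
have c1 : 0 < 1 + k by rewrite addr_gt0.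
apply: (le_trans (ler_wpM2r L0 W'le)); rewrite -[leLHS]mulrA ler_wpM2l//.
apply: (@le_trans _ _ (1 + k)^-1).
  rewrite expRN -[leRHS]mul1r ler_pdivlMr// -mulrA ler_pdivrMl ?expR_gt0// mulr1 mulrC.
  by apply: (le_trans kL); apply: (le_trans _ (expR_ge1Dx _)); rewrite lerDr.
have invE : (1 + k)^-1 = 1 - k / (1 + k) by field; rewrite gt_eqF.
by rewrite [leLHS]invE lerD2l lerN2 ler_piMr// divr_ge0 ?(ltW k0) ?(ltW c1).
Qed.

End asymptotics.

(** * Drift of the autoregressive kernel *)

Section drift_estimates.
Context (R : realType) (dO : measure_display) (Omega : measurableType dO).
Context (Pr : probability Omega R) (d : nat).
Context (f : 'rV[R]_d -> 'rV[R]_d) (eps0 : {RV Pr >-> 'rV[R]_d}).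
Context (z0 g0 r R0 rho : R).
Context (z00 : 0 < z0) (g01 : 0 < g0 <= 1) (r0 : 0 < r) (R00 : 0 < R0).
Context (rho0 : 0 <= rho < 2).
Context (momE : ('E_Pr[@expV R d z0 g0 \o eps0] < +oo)%E).
Context (zmE : zero_mean eps0).
Context (fE : g_assumption f r R0 rho).

Implicit Types (g z k K : R) (x : 'rV[R]_d).
Let P := nlar_kernel f eps0.
Let mu := fine 'E_Pr[@expV R d z0 g0 \o eps0].

Lemma exp_moment_ge0 : 0 <= mu.
Proof. by apply: fine_ge0; apply: expectation_ge0 => w; apply: ltW; apply: expV_gt0. Qed.

Lemma kernel_app_expV_le z g x : 0 <= z <= z0 -> 0 < g <= g0 ->
  (kernel_app P (expV z g) x <= (expV z g (f x) * (expR z0 * mu))%:E)%E.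
Proof.
move=> hz hg; have /andP[_ g1] := g01.
have h e : expV z g (f x + e) <=
    0 + 0 * edot 0 e + expV z g (f x) * expR z0 * expV z0 g0 e.
  by rewrite mul0r !add0r -mulrA expV_add_le_mul.
have := kernel_app_le (expV_measurable_fun z g) _ (expV_measurable_fun z0 g0) _
  momE zmE h.
rewrite add0r mulrA; apply => u; exact/ltW/expV_gt0.
Qed.

Lemma kernel_app_expV_le_second_order : exists2 K, 0 < K & forall z g x,
  0 <= z <= z0 / 2 -> 0 < g <= g0 -> 0 < enorm (f x) ->
  (kernel_app P (expV z g) x <= (expV z g (f x) *
    (1 + K * (z * enorm (f x) `^ (g - 2) +
      z ^+ 2 * enorm (f x) `^ (2 * g - 2))))%:E)%E.
Proof.
have /andP[g00 g1] := g01.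
have [K K0 hK] := sqr_expR_powR_le z00 g00.
exists (K * mu + 1); first by have := mulr_ge0 (ltW K0) exp_moment_ge0; lra.
move=> z g x hz hg y0; have /andP[z_ge0 _] := hz.
set B := _ + z ^+ 2 * _; set W := expV z g (f x).
have W0 : 0 <= W by apply/ltW/expV_gt0.
have B0 : 0 <= B by rewrite addr_ge0 ?mulr_ge0 ?powR_ge0 ?sqr_ge0.
have h e : expV z g (f x + e) <=
    W + W * (z * enorm (f x) `^ (g - 2) * g) * edot (f x) e +
    W * (K * B) * expV z0 g0 e.
  by apply: le_trans (expV_add_le_second_order e hK hz hg g1 y0) _; rewrite -/B -/W; lra.
have := kernel_app_le (expV_measurable_fun z g) _ (expV_measurable_fun z0 g0) _
  momE zmE h.
move=> /(_ (fun=> ltW (expV_gt0 _ _ _)) (fun=> ltW (expV_gt0 _ _ _))) /le_trans; apply.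
rewrite lee_fin -/mu; have := mulr_ge0 W0 B0; lra.
Qed.

(** The tangent of the power function at |x|, applied to the assumed contraction
    |g(x)| <= |x| - r |x|^(1 - rho). *)
Lemma enorm_contraction g x : 0 < g <= 1 -> R0 <= enorm x ->
  enorm (f x) `^ g <= enorm x `^ g - g * r * enorm x `^ (g - rho).
Proof.
move=> hg Rx; have /andP[g_gt0 g1] := hg.
have x0 : 0 < enorm x by apply: lt_le_trans Rx.
have hf := fE.2 _ Rx.
have := powR_tangent hg (enorm_ge0 (f x)) x0.
move=> /le_trans; apply; rewrite lerD2l.
have -> : enorm x `^ (g - rho) = enorm x `^ (g - 1) * (enorm x * enorm x `^ (- rho)).
  rewrite -{3}[enorm x]powRr1 ?enorm_ge0// -!powRD ?(gt_eqF x0) ?implybT//.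
  by congr (_ `^ _); ring.
have : enorm (f x) - enorm x <= - (r * (enorm x * enorm x `^ (- rho))) by lra.
move=> /(ler_wpM2l (mulr_ge0 (ltW g_gt0) (powR_ge0 (enorm x) (g - 1)))); lra.
Qed.

(** The exponent is written as twice the amount that survives the noise. *)
Lemma expV_contraction g z x : 0 < g <= 1 -> 0 <= z -> R0 <= enorm x ->
  expV z g (f x) <= expV z g x *
    expR (- (2 * (z * (g * r) / 2 * enorm x `^ (g - rho)))).
Proof.
move=> hg z_ge0 Rx; rewrite /expV -expRD ler_expR.
by have := ler_wpM2l z_ge0 (enorm_contraction hg Rx); lra.
Qed.

Lemma expV_half g z x : 0 < g -> 0 <= z -> enorm (f x) < enorm x / 2 ->
  expV z g (f x) <= expV z g x * expR (- (z * (1 - 2^-1 `^ g) * enorm x `^ g)).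
Proof.
move=> g_gt0 z_ge0 yu; rewrite /expV -expRD ler_expR.
have : enorm (f x) `^ g <= enorm x `^ g * 2^-1 `^ g.
  rewrite -powRM ?enorm_ge0 ?invr_ge0//.
  by rewrite ge0_ler_powR ?nnegrE ?enorm_ge0 ?(ltW yu) ?(ltW g_gt0)// divr_ge0 ?enorm_ge0.
by move=> /(ler_wpM2l z_ge0); lra.
Qed.

(** The estimate behind both drift conditions: for g < rho the factor tends to 1 and
    gives the subgeometric condition; for g = rho it is a constant below 1 and
    gives geometric drift. *)
Lemma drift_subgeometric g : 0 < g <= g0 -> g <= rho -> g <= 2 - rho ->
  exists z k M, [/\ 0 < z < z0, 0 < k & forall x, M <= enorm x ->
    0 < enorm x /\
    (kernel_app P (expV z g) x <=
     (expV z g x * (1 - k / (1 + k) * enorm x `^ (g - rho)))%:E)%E].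
Proof.
move=> hg grho g2rho; have /andP[g_gt0 gg0] := hg; have /andP[_ g01'] := g01.
have hg1 : 0 < g <= 1 by rewrite g_gt0/= (le_trans gg0).
have [K K0 hK] := kernel_app_expV_le_second_order.
have gr0 : 0 < g * r by rewrite mulr_gt0.
(* 16 = 4 * 4: the noise terms carry 4 K, and each may cost a quarter of g r. *)
set z := Num.min (z0 / 2) (g * r / (16 * K)).
have z_gt0 : 0 < z by rewrite lt_min !divr_gt0// mulr_gt0.
have z_ge0 := ltW z_gt0.
have zz0 : z <= z0 / 2 by rewrite ge_min lexx.
have zlt : z < z0 by apply: (le_lt_trans zz0); rewrite ltr_pdivrMr// ltr_pMr// ltr1n.
have zK : 4 * K * z <= g * r / 4.
  have : z <= g * r / (16 * K) by rewrite ge_min lexx orbT.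
  rewrite ler_pdivlMr ?mulr_gt0//; lra.
set k := z * (g * r) / 2; have k0 : 0 < k by rewrite /k divr_gt0// mulr_gt0.
(* When |g(x)| < |x| / 2, the exponent drops by at least z (1 - 2^(-g)) |x|^g. *)
have th0 : 0 < 1 - 2^-1 `^ g.
  have one : 1 `^ g = 1 by rewrite powR1.
  rewrite subr_gt0 -[ltRHS]one; apply: gt0_ltr_powR; rewrite ?nnegrE ?invr_ge0//.
  by rewrite invf_lt1// ltr1n.
have zth := mulr_gt0 z_gt0 th0.
have /andP[_ rho2] := rho0.
have [M1 hM1] :=
  powR_eventually_ge ((1 + k) * (expR z0 * mu) / (z * (1 - 2^-1 `^ g))) g_gt0.
have [|M2 hM2] := @powR_eventually_ge _ (2 - rho) (16 * K / (g * r)).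
  by rewrite subr_gt0.
exists z, k, (Num.max (Num.max M1 M2) (Num.max R0 1)).
split=> [||x]; rewrite ?z_gt0//=.
rewrite !ge_max => /andP[/andP[/hM1 h1 /hM2 h2] /andP[Rx x1]].
have x0 : 0 < enorm x by apply: lt_le_trans Rx.
split=> //.
have q01 : 0 <= enorm x `^ (g - rho) <= 1.
  by rewrite powR_ge0/= -(powRr0 (enorm x)); apply: ler_powR => //; rewrite subr_le0.
have [uy|yu] := leP (enorm x / 2) (enorm (f x)).
  have y0 : 0 < enorm (f x) by apply: lt_le_trans uy; rewrite divr_gt0.
  apply: (le_trans (hK z g x _ hg y0)); first by rewrite z_ge0.
  rewrite lee_fin; apply: drift_factor_near_le => //.
  - exact/ltW/expV_gt0.
  - exact/ltW/expV_gt0.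
  - by rewrite mulr_ge0 ?(ltW K0)// addr_ge0 ?mulr_ge0 ?powR_ge0 ?sqr_ge0.
  - exact: noise_correction_le.
  - exact: expV_contraction.
apply: (le_trans (kernel_app_expV_le x _ hg)); first by rewrite z_ge0 ltW.
rewrite lee_fin.
apply: (drift_factor_far_le (t := z * (1 - 2^-1 `^ g) * enorm x `^ g)) => //.
- exact/ltW/expV_gt0.
- by rewrite mulr_ge0 ?expR_ge0 ?exp_moment_ge0.
- by rewrite -ler_pdivrMl// [leLHS]mulrC.
- exact: expV_half.
Qed.

End drift_estimates.

(** * Concavity from supporting lines *)

Section supporting_lines.
Context {R : realType}.
Implicit Types (f h D phi : R -> R) (a b c t u v w x y : R).

Lemma antitone_derivative_supporting_line f D :
  (forall v, is_derive v 1 f (D v)) -> {homo D : u v /~ u <= v} ->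
  forall x y, f y <= f x + D x * (y - x).
Proof.
move=> df Dmon x y.
have MV u v : u < v -> exists2 c, u < c < v & f v - f u = D c * (v - u).
  move=> uv; have fc : {within `[u, v], continuous f}.
    by apply: derivable_within_continuous => w _; exact: ex_derive.
  have [c] := MVT uv (fun w _ => df w) fc.
  by rewrite in_itv/= => cuv fE; exists c.
have [xy|yx|->] := ltgtP x y; last by rewrite subrr mulr0 addr0.
- have [c /andP[xc _] fE] := MV _ _ xy.
  by have := Dmon _ _ (ltW xc); nra.
- have [c /andP[_ cx] fE] := MV _ _ yx.
  by have := Dmon _ _ (ltW cx); nra.
Qed.

(** The average of the supporting lines at the mean point w, evaluated at x and
    y: the slopes cancel. *)
Lemma supporting_line_concave f D (A : set R^o) :
  (forall x y, f y <= f x + D x * (y - x)) -> convex_function A (fun v => - f v).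
Proof.
move=> sl t x y _ _; have t0 : 0 <= t%:num by [].
have t1 : 0 <= 1 - t%:num by rewrite subr_ge0.
change (- f (t%:num * x + (1 - t%:num) * y) <= t%:num * - f x + (1 - t%:num) * - f y).
move: (t%:num : R) t0 t1 => s s0 s1; set w := s * x + (1 - s) * y.
have hx := ler_wpM2l s0 (sl w x); have hy := ler_wpM2l s1 (sl w y).
have : s * (x - w) + (1 - s) * (y - w) = 0 by rewrite /w; ring.
clearbody w; move=> /(congr1 (fun e => D w * e)); rewrite mulr0; lra.
Qed.

(** Each difference quotient of the glued function is one of f or one of h. *)
Lemma is_derive_glue f h v b :
  is_derive v 1 f b -> is_derive v 1 h b -> f v = h v ->
  is_derive v 1 (fun x => if v <= x then f x else h x) b.
Proof.
move=> [df Df] [dh Dh] fh.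
set k := fun x => _.
have qf : (fun t => t^-1 *: (f (t *: 1 + v) - f v)) @ 0^' --> b by rewrite -Df.
have qh : (fun t => t^-1 *: (h (t *: 1 + v) - h v)) @ 0^' --> b by rewrite -Dh.
have qk : (fun t => t^-1 *: (k (t *: 1 + v) - k v)) @ 0^' --> b.
  apply/cvgrPdist_le => e e0.
  move/cvgrPdist_le/(_ _ e0) : qf; move/cvgrPdist_le/(_ _ e0) : qh.
  move=> qh qf; near=> t.
  by rewrite /k lexx; case: ifP => _; [|rewrite fh]; near: t.
apply: DeriveDef; first by apply/cvg_ex; exists b.
exact: cvg_lim qk.
Unshelve. all: by end_near. Qed.

(** Replacing f below v0 by its tangent at v0 makes it differentiable on the
    whole line, so that the mean value theorem applies without boundary cases. *)
Lemma is_derive_affine_ext f D (v0 : R) :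
  (forall v, v0 <= v -> is_derive v 1 f (D v)) ->
  forall v, is_derive v 1 (fun x => if v0 <= x then f x else f v0 + D v0 * (x - v0))
    (D (Num.max v v0)).
Proof.
move=> df v.
have dl x : is_derive x 1 (fun x => f v0 + D v0 * (x - v0)) (D v0).
  by apply: is_derive_eq; rewrite /GRing.scale/=; ring.
have [vv0|v0v|vE] := ltgtP v v0.
- apply: near_eq_is_derive (dl v); near=> x.
  by rewrite leNgt ifN// negbK; near: x; exact: lt_nbhsl.
- apply: near_eq_is_derive (df v (ltW v0v)); near=> x.
  by rewrite ifT//; apply: ltW; near: x; exact: lt_nbhsr.
- by rewrite vE; apply: is_derive_glue; [exact: df|rewrite subrr mulr0 addr0].
Unshelve. all: by end_near. Qed.

Lemma derivable_differentiable_from1 phi :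
  (forall v, 1 <= v -> derivable phi v 1) -> differentiable_from1 phi.
Proof.
move=> dphi; split=> [v /ltW|]; first exact: dphi.
have /cvg_ex[l hl] := dphi 1 (lexx 1).
apply/cvg_ex; exists l.
have qE : (fun t : R => t^-1 * (phi (1 + t) - phi 1)) =
    (fun t => t^-1 *: (phi (t *: 1 + 1) - phi 1)).
  by apply/funext => t; rewrite [t *: _]mulr1 (addrC t).
rewrite qE; apply: cvg_trans hl => A.
rewrite /= !nbhs_simpl /at_right /dnbhs /within/= => hA.
near=> t => tpos; have : t != 0 by rewrite gt_eqF.
by near: t.
Unshelve. all: by end_near.
Qed.

End supporting_lines.

(** * The logarithmic rate *)

Section log_rate_function.
Context {R : realType}.
Context (c a : R).
Implicit Types u v w s t : R.

Definition log_rate_deriv v :=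
  c * (1 + ln v) `^ (a - 1) * (1 + ln v + a).

Lemma is_derive_log_rate v : 1 <= v ->
  is_derive v 1 (log_rate c a) (log_rate_deriv v).
Proof.
move=> v1; have v0 : 0 < v by lra.
have u0 : 0 < 1 + ln v by have := ln_ge0 v1; lra.
have dln : is_derive v 1 (@ln R) v^-1 by exact: is_derive1_ln.
have du : is_derive v 1 (fun x => 1 + ln x) v^-1.
  by apply: is_derive_eq; rewrite /GRing.scale/=; ring.
have dp : is_derive v 1 (fun x => (1 + ln x) `^ a) (a * (1 + ln v) `^ (a - 1) * v^-1).
  exact: (@is_derive1_comp _ (fun s => s `^ a) (fun x => 1 + ln x) v _ _
    (is_derive1_powR a u0) du).
have dl : is_derive v 1 (fun x => c * x) c.
  by apply: is_derive_eq; rewrite /GRing.scale/=; ring.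
have dM := is_deriveM dl dp.
have -> : log_rate c a = (fun x => c * x) * (fun x => (1 + ln x) `^ a) by [].
apply: is_derive_eq.
rewrite /log_rate_deriv.
have <- : (1 + ln v) * (1 + ln v) `^ (a - 1) = (1 + ln v) `^ a.
  by rewrite -{1}[1 + ln v]powRr1 ?(ltW u0)// -powRD ?(gt_eqF u0) ?implybT// subrKC.
rewrite /GRing.scale/=; field; exact: lt0r_neq0.
Qed.

Lemma log_rate_gt0 v : 0 < c -> 1 <= v -> 0 < log_rate c a v.
Proof.
move=> c0 v1; rewrite /log_rate !mulr_gt0 ?powR_gt0//; first by lra.
by have := ln_ge0 v1; lra.
Qed.

(** Here 1 + ln v0 = 1 - a, the point from which the rate is concave. *)
Let v0 := expR (- a).

Let v0_gt1 : a < 0 -> 1 < v0.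
Proof. by move=> a0; rewrite -expR0 ltr_expR; lra. Qed.

Lemma log_rate_deriv_antitone : 0 < c -> a < 0 ->
  {homo log_rate_deriv \o Num.max ^~ v0 : u v /~ u <= v}.
Proof.
move=> c0 a0 u v uv /=.
have mon : Num.max v v0 <= Num.max u v0 by rewrite ge_max !le_max uv lexx orbT.
have w0 : v0 <= Num.max v v0 by rewrite le_max lexx orbT.
move: (Num.max v v0) (Num.max u v0) mon w0 => s t st v0s.
have s0 : 0 < s by have := v0_gt1 a0; lra.
have ls : - a <= ln s by rewrite -[leLHS]expRK ler_ln ?posrE ?expR_gt0.
have lst : ln s <= ln t by rewrite ler_ln ?posrE//; lra.
rewrite /log_rate_deriv -!mulrA ler_wpM2l ?(ltW c0)// powR_shift_antitone//; lra.
Qed.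

Lemma log_rate_deriv_ge0 v : 0 < c -> a < 0 ->
  0 <= log_rate_deriv (Num.max v v0).
Proof.
move=> c0 a0; have w0 : v0 <= Num.max v v0 by rewrite le_max lexx orbT.
move: (Num.max v v0) w0 => s v0s.
have s0 : 0 < s by have := v0_gt1 a0; lra.
have ls : - a <= ln s by rewrite -[leLHS]expRK ler_ln ?posrE ?expR_gt0.
rewrite /log_rate_deriv !mulr_ge0 ?powR_ge0 ?(ltW c0)//; lra.
Qed.

(** Below expR (- a) the rate is replaced by its tangent at that point.  Positivity
    at 1 comes from a < 0, which places the intercept of the tangent above 0. *)
Lemma log_rate_eventually_rate_function : 0 < c -> a < 0 -> exists (phi0 : R -> R) v1,
  [/\ 1 <= v1, forall v, v1 <= v -> phi0 v = log_rate c a v & rate_function phi0].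
Proof.
move=> c0 a0; set phi0 := fun v => if v0 <= v then log_rate c a v else
  log_rate c a v0 + log_rate_deriv v0 * (v - v0).
have dphi0 : forall v, is_derive v 1 phi0 (log_rate_deriv (Num.max v v0)).
  apply: is_derive_affine_ext => v v0v; apply: is_derive_log_rate.
  by have := v0_gt1 a0; lra.
have sl := antitone_derivative_supporting_line dphi0 (log_rate_deriv_antitone c0 a0).
have mon : {homo phi0 : u v / u <= v}.
  move=> u v uv; apply: (le_trans (sl v u)).
  have := log_rate_deriv_ge0 v c0 a0; rewrite /=; nra.
exists phi0, v0; split=> [|v v0v|]; first exact/ltW/v0_gt1.
  by rewrite /phi0 v0v.
split.
- move=> v /mon; apply: lt_le_trans; rewrite /phi0 leNgt v0_gt1//=.
  rewrite /log_rate_deriv /log_rate expRK.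
  have u0 : 0 < 1 - a by lra.
  have -> : (1 - a) `^ a = (1 - a) * (1 - a) `^ (a - 1).
    by rewrite -{2}[1 - a]powRr1 ?(ltW u0)// -powRD ?(gt_eqF u0) ?implybT// subrKC.
  have -> : c * v0 * ((1 - a) * (1 - a) `^ (a - 1)) +
    c * (1 - a) `^ (a - 1) * (1 - a + a) * (1 - v0) =
    c * (1 - a) `^ (a - 1) * (1 + (- a) * v0) by ring.
  rewrite !mulr_gt0 ?powR_gt0// addr_gt0// mulr_gt0 ?expR_gt0//; lra.
- by move=> u v _ _; exact: mon.
- exact: supporting_line_concave sl.
- by apply: derivable_differentiable_from1 => v _; exact: ex_derive.
Qed.

End log_rate_function.

(** * From bounds inside and outside a ball to drift conditions *)

Section assembling.
Context (R : realType) (d : nat).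
Context (P : 'rV[R]_d -> set 'rV[R]_d -> \bar R) (V : 'rV[R]_d -> R) (M B : R).
Implicit Types (phi : R -> R) (x : 'rV[R]_d).

Lemma drift_from_bounds phi B' :
  (forall x, 0 <= V x) ->
  (forall x, enorm x <= M -> (kernel_app P V x <= B%:E)%E) ->
  (forall x, enorm x <= M -> phi (V x) <= B') ->
  (forall x, M < enorm x -> (kernel_app P V x + (phi (V x))%:E <= (V x)%:E)%E) ->
  drift P phi V (cball d M) (B + B').
Proof.
move=> V0 kB phiB kV x; rewrite indicE; have [xM|xM] := boolP (x \in _).
  have {}xM : enorm x <= M by move: xM; rewrite inE.
  rewrite mulr1; apply: (@le_trans _ _ (B + B')%:E); last by rewrite -EFinD lee_fin lerDr.
  by rewrite EFinD; apply: leeD; [exact: kB|rewrite lee_fin phiB].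
rewrite mulr0 adde0; apply: kV; rewrite ltNge; apply/negP => xM'.
by move/negP: xM; apply; rewrite inE.
Qed.

Lemma foster_lyapunov_from_bounds lambda :
  (forall x, 0 <= V x) -> 0 <= lambda ->
  (forall x, enorm x <= M -> (kernel_app P V x <= B%:E)%E) ->
  (forall x, M < enorm x -> (kernel_app P V x <= (lambda * V x)%:E)%E) ->
  foster_lyapunov P V (cball d M) lambda (`|B| + 1).
Proof.
move=> V0 l0 kB kV x; rewrite indicE; have [xM|xM] := boolP (x \in _).
  have {}xM : enorm x <= M by move: xM; rewrite inE.
  rewrite mulr1; apply: (le_trans (kB x xM)); rewrite -EFinD lee_fin.
  by have := ler_norm B; have := mulr_ge0 l0 (V0 x); lra.
rewrite mulr0 adde0; apply: kV; rewrite ltNge; apply/negP => xM'.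
by move/negP: xM; apply; rewrite inE.
Qed.

End assembling.

Lemma expV_ge1 (R : realType) (d : nat) (z g : R) (x : 'rV[R]_d) :
  0 <= z -> 1 <= expV z g x.
Proof. by move=> z0; rewrite -expR0 ler_expR mulr_ge0 ?powR_ge0. Qed.

Lemma expV_le_on_cball (R : realType) (d : nat) (z g M : R) (x : 'rV[R]_d) :
  0 <= z -> 0 <= g -> enorm x <= M -> expV z g x <= expR (z * M `^ g).
Proof.
move=> z0 g0 xM; rewrite ler_expR ler_wpM2l// ge0_ler_powR ?nnegrE ?enorm_ge0//.
exact: le_trans (enorm_ge0 x) xM.
Qed.

(** As ln (V x) = z |x|^g, the rate at V x is a multiple of
    V x * (1 + z |x|^g) `^ a with g a = g - rho; dropping the 1 is allowed because
    a is negative, and the factor z `^ a is absorbed in the constant. *)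
Lemma log_rate_expV_le (R : realType) (d : nat) (z k g rho : R) (x : 'rV[R]_d) :
  0 < z -> 0 < k -> 0 < g -> g < rho -> 0 < enorm x ->
  log_rate (k / z `^ (1 - rho / g)) (1 - rho / g) (expV z g x) <=
  expV z g x * (k * enorm x `^ (g - rho)).
Proof.
move=> z0 k0 g0 grho x0; set a := 1 - rho / g.
have a0 : a <= 0 by rewrite subr_le0 ler_pdivlMr// mul1r ltW.
have za0 : 0 < z `^ a by rewrite powR_gt0.
have s0 : 0 < z * enorm x `^ g by rewrite mulr_gt0 ?powR_gt0.
have -> : k * enorm x `^ (g - rho) = k / z `^ a * (z * enorm x `^ g) `^ a.
  rewrite powRM ?powR_ge0 ?(ltW z0)// -powRrM.
  have -> : g * a = g - rho by rewrite /a; field; rewrite gt_eqF.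
  by field; rewrite gt_eqF.
rewrite /log_rate expRK [leLHS]mulrAC [leLHS]mulrC ler_wpM2l ?expR_ge0//.
rewrite ler_wpM2l ?divr_ge0 ?(ltW k0) ?(ltW za0)//.
rewrite -[a]opprK !(powRN _ (- a)) lef_pV2 ?posrE ?powR_gt0 ?addr_gt0//.
by rewrite ge0_ler_powR ?nnegrE ?oppr_ge0 ?(ltW s0) ?addr_ge0// ?(ltW s0)// lerDr.
Qed.

Lemma log_rate_le (R : realType) (c a v w : R) : 0 <= c -> a <= 0 ->
  1 <= v <= w -> log_rate c a v <= c * w.
Proof.
move=> c0 a0 /andP[v1 vw]; rewrite /log_rate.
have u1 : 1 <= 1 + ln v by rewrite lerDl ln_ge0.
have u2 : (1 + ln v) `^ a <= 1 by rewrite -[leRHS](powRr0 (1 + ln v)) ler_powR.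
have v0 : 0 <= v by rewrite (le_trans _ v1).
rewrite -[c * w]mulr1 ler_pM ?powR_ge0 ?mulr_ge0// ler_wpM2l//.
Qed.

(** * The drift conditions *)

Theorem theorem3p3 (R : realType) (d : nat) (hd : (0 < d)%N)
    (dO : measure_display) (Omega : measurableType dO)
    (Pr : probability Omega R)
    (eps : nat -> {RV Pr >-> 'rV[R]_d}) (Phi : nat -> {RV Pr >-> 'rV[R]_d})
    (g : 'rV[R]_d -> 'rV[R]_d) (z0 gamma0 r R0 rho : R)
    (hz0 : 0 < z0) (hgamma0 : 0 < gamma0 <= 1)
    (hr : 0 < r) (hR0 : 0 < R0) (hrho : 0 <= rho < 2)
    (hnoise : noise_assumption (Phi 0%N) eps z0 gamma0)
    (hg : g_assumption g r R0 rho)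
    (hPhi : forall n w, Phi n.+1 w = g (Phi n w) + eps n.+1 w) :
  let P := nlar_kernel g (eps 0%N) in
  let gamma := Num.min gamma0 (2 - rho) in
  (gamma0 < rho ->
     exists z c M : R,
       [/\ 0 < z < z0, 0 < c, R0 <= M
         & condition_D_ult P (log_rate c (1 - rho / gamma))
             (expV z gamma) (cball d M)]) /\
  (rho <= gamma0 ->
     exists z lambda b M : R,
       [/\ (rho < gamma0 -> z = z0) /\ (rho = gamma0 -> 0 < z < z0),
           0 < lambda < 1, 0 < b, R0 <= M
         & foster_lyapunov P (expV z gamma0) (cball d M) lambda b]).
Proof.
move=> P gamma.
have [[_ _] _ /(_ 0%N) zm mom _] := hnoise.
have /andP[g00 g01] := hgamma0; have /andP[rho0 rho2] := hrho.
have bounded (z q M : R) : 0 <= z <= z0 -> 0 < q <= gamma0 ->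
    exists B, forall x, enorm x <= M -> (kernel_app P (expV z q) x <= B%:E)%E.
  move=> hz hgg; have /andP[z_ge0 _] := hz; have /andP[q_gt0 _] := hgg.
  have [B B0 hB] := continuous_bounded_on_cball M hg.1.
  exists (expR (z * B `^ q) * (expR z0 * fine 'E_Pr[@expV R d z0 gamma0 \o eps 0%N])).
  move=> x xM; apply: (le_trans (kernel_app_expV_le g hgamma0 mom zm x hz hgg)).
  rewrite lee_fin ler_wpM2r ?expV_le_on_cball ?(ltW q_gt0) ?hB//.
  by rewrite mulr_ge0 ?expR_ge0 ?exp_moment_ge0.
split=> [grho|rhog].
- have gam0 : 0 < gamma by rewrite lt_min g00 subr_gt0.
  have gamg : gamma <= gamma0 by rewrite ge_min lexx.
  have gam2 : gamma <= 2 - rho by rewrite ge_min lexx orbT.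
  have gamrho : gamma < rho by apply: le_lt_trans grho.
  have hgam : 0 < gamma <= gamma0 by rewrite gam0.
  have [z [k [M0 [hz k0 hM0]]]] :=
    drift_subgeometric hz0 hgamma0 hr hR0 hrho mom zm hg hgam (ltW gamrho) gam2.
  have /andP[z_gt0 zz0] := hz.
  set a := 1 - rho / gamma; have a0 : a < 0 by rewrite subr_lt0 ltr_pdivlMr// mul1r.
  set k' := k / (1 + k); have k'0 : 0 < k' by rewrite divr_gt0// addr_gt0.
  set c := k' / z `^ a; have c0 : 0 < c by rewrite divr_gt0// powR_gt0.
  have [phi0 [v1 [v11 phiE rphi0]]] := log_rate_eventually_rate_function c0 a0.
  have [M1 hM1] := powR_eventually_ge (v1 / z) gam0.
  (* Beyond M1 the value of V exceeds v1, where phi0 and the rate agree. *)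
  pose M := Num.max R0 (Num.max M0 M1).
  have [|B hB] := bounded z gamma M _ hgam; first by rewrite !ltW.
  have V1 (x : 'rV[R]_d) : 1 <= expV z gamma x by apply: expV_ge1; exact: ltW.
  have V0 (x : 'rV[R]_d) : 0 <= expV z gamma x by exact/ltW/expV_gt0.
  have VM (x : 'rV[R]_d) : enorm x <= M -> expV z gamma x <= expR (z * M `^ gamma).
    by apply: expV_le_on_cball; exact: ltW.
  have outside x : M < enorm x ->
      (kernel_app P (expV z gamma) x + (log_rate c a (expV z gamma x))%:E
       <= (expV z gamma x)%:E)%E.
    rewrite !gt_max => /andP[_ /andP[/ltW xM0 _]].
    have [x0 hx] := hM0 x xM0.
    apply: (le_trans (leeD hx (lexx _))); rewrite -EFinD lee_fin.
    rewrite mulrBr mulr1 -/k' -lerBrDl opprB addrCA subrr addr0.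
    exact: log_rate_expV_le.
  exists z, c, M; split=> //; first by rewrite le_max lexx.
  split.
  + split=> [v v1_|]; first exact: log_rate_gt0.
    apply: derivable_differentiable_from1 => v v1_.
    have dv : is_derive v 1 (log_rate c a) (log_rate_deriv c a v).
      exact: is_derive_log_rate.
    exact: ex_derive.
  + exists (B + c * expR (z * M `^ gamma)); apply: drift_from_bounds => // x xM.
    by apply: log_rate_le; rewrite ?(ltW c0) ?(ltW a0) ?V1 ?VM.
  + exists phi0, v1; split=> //; split=> //; first exact: cball_measurable.
    have [_ mon _ _] := rphi0.
    exists (B + phi0 (expR (z * M `^ gamma))); apply: drift_from_bounds => // x xM.
      apply: (mon _ _ _ _ (VM x xM)); rewrite in_itv/= andbT; first exact: V1.
      exact: le_trans (V1 x) (VM x xM).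
    rewrite phiE; first exact: outside.
    move: xM; rewrite !gt_max => /andP[_ /andP[_ /ltW /hM1]].
    rewrite ler_pdivrMr// mulrC => /le_trans; apply.
    by apply: (le_trans _ (expR_ge1Dx _)); rewrite lerDr.
- have V0 (z : R) (x : 'rV[R]_d) : 0 <= expV z gamma0 x by exact/ltW/expV_gt0.
  have hgam : 0 < gamma0 <= gamma0 by rewrite g00 lexx.
  have [rhoE|rhoN] := eqVneq rho gamma0.
    have [||z [k [M0 [hz k0 hM0]]]] :=
        drift_subgeometric hz0 hgamma0 hr hR0 hrho mom zm hg hgam.
    - by rewrite rhoE.
    - by rewrite rhoE; lra.
    have /andP[z_gt0 zz0] := hz.
    have [|B hB] := bounded z gamma0 (Num.max R0 M0) _ hgam; first by rewrite !ltW.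
    have k1 : 0 < 1 + k by rewrite addr_gt0.
    have lE : 1 - k / (1 + k) = (1 + k)^-1 by field; rewrite gt_eqF.
    exists z, (1 - k / (1 + k)), (`|B| + 1), (Num.max R0 M0).
    split; first by split=> // rholt; move: rholt; rewrite rhoE ltxx.
    + by rewrite lE invr_gt0 k1 invf_lt1// ltrDl.
    + by rewrite ltr_wpDl.
    + by rewrite le_max lexx.
    apply: foster_lyapunov_from_bounds => //; first by rewrite lE invr_ge0 ltW.
    move=> x; rewrite gt_max => /andP[_ /ltW /hM0[_]].
    by rewrite rhoE subrr powRr0 mulr1 mulrC.
  (* For rho < gamma0 the gain in the exponent tends to infinity, so the bound
     without cancellation suffices and z need not be small. *)
  have {rhoN} rholt : rho < gamma0 by rewrite lt_neqAle rhoN.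
  set L := expR z0 * fine 'E_Pr[@expV R d z0 gamma0 \o eps 0%N].
  have L0 : 0 <= L by rewrite mulr_ge0 ?expR_ge0 ?exp_moment_ge0.
  have t0 : 0 < z0 * (gamma0 * r) by rewrite !mulr_gt0.
  have [|M0 hM0] :=
      @powR_eventually_ge _ (gamma0 - rho) ((1 + 1) * L / (z0 * (gamma0 * r))).
    by rewrite subr_gt0.
  have hz : 0 <= z0 <= z0 by rewrite lexx ltW.
  have [B hB] := bounded z0 gamma0 (Num.max R0 M0) hz hgam.
  (* The value of the factor of drift_factor_far_le at k = q = 1. *)
  have lE : 1 - 1 / (1 + 1) * 1 = 2^-1 :> R by field.
  exists z0, 2^-1, (`|B| + 1), (Num.max R0 M0).
  split; first by split=> // rhoE; move: rholt; rewrite rhoE ltxx.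
  + by rewrite invr_gt0 ltr0n invf_lt1// ltr1n.
  + by rewrite ltr_wpDl.
  + by rewrite le_max lexx.
  apply: foster_lyapunov_from_bounds => //.
  move=> x; rewrite gt_max => /andP[/ltW Rx /ltW /hM0 h].
  apply: (le_trans (kernel_app_expV_le g hgamma0 mom zm x hz hgam)).
  rewrite lee_fin [leRHS]mulrC -lE.
  apply: drift_factor_far_le (expV_contraction hR0 hg hgamma0 (ltW hz0) Rx) => //.
  + by rewrite lexx ler01.
  + by move: h; rewrite ler_pdivrMr// => /le_trans; apply; lra.
Qed.
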